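(* Consider the one-hop wireless network model described in the context, where the channel powers $\gamma_{i,j}$ are i.i.d. with the generalized Pareto distribution with p.d.f. $f(x)=\frac{\alpha}{(1+x)^{\alpha+1}}$ and c.d.f. $F(x)=1-\frac{1}{(1+x)^{\alpha}}$ for $x\ge0$, where $\alpha>2$. Then, with high probability, the achievable throughput (obtained by activating the source-destination pairs with the largest direct-link powers and silencing the rest) satisfies $T=\Omega\left(n^{1/(1+\alpha)}\right)$.
   Context: Network model: $n$ sources $S_1,\dots,S_n$ and $n$ destinations $D_1,\dots,D_n$; $S_i$ wishes to communicate with $D_i$ in one hop. The channel power from $S_i$ to $D_j$ is $\gamma_{i,j}\ge0$; all $\gamma_{i,j}$ are i.i.d. with mean $\mu$. A subset $\mathbb{S}$ of sources is active, each with power $1$; $SINR_i=\frac{\gamma_{i,i}}{N_0+\sum_{S_k\in\mathbb{S},k\ne i}\gamma_{k,i}}$ for $S_i\in\mathbb{S}$ (and $0$ otherwise), with noise variance $N_0\ge0$; $D_i$ succeeds if $SINR_i>\beta$ for a fixed constant $\beta>0$. The throughput $T$ is the number of successful destinations. ''With high probability'' means with probability tending to $1$ as $n\to\infty$. *)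

(* Defs.v *)
From HB Require Import structures.
From mathcomp Require Import all_boot all_order all_algebra.
From mathcomp Require Import all_classical all_reals all_analysis.
Set Implicit Arguments. Unset Strict Implicit. Unset Printing Implicit Defensive.
Import Order.TTheory GRing.Theory Num.Theory.
Import numFieldNormedType.Exports.
Local Open Scope classical_set_scope.
Local Open Scope ring_scope.

Definition pareto_cdf (R : realType) (alpha x : R) : R :=
  if x < 0 then 0 else 1 - (1 + x) `^ (- alpha).

(* Mutual independence of a finite family of real random variables X_p, p : I:
   for every family of Borel sets B_p, the probability of the intersection of the
   events {X_p in B_p} is the product of the probabilities (taking B_p = setT
   recovers every subfamily). *)
Definition mutually_independent (R : realType) (d : measure_display)
  (T : measurableType d) (P : probability T R) (I : finType) (X : I -> T -> R) :=
  forall B : I -> set R, (forall p, measurable (B p)) ->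
    fine (P (\bigcap_(p in [set: I]) (X p @^-1` B p))) =
    \prod_(p : I) fine (P (X p @^-1` B p)).

(* Destination D_i (i in the active set S) succeeds iff SINR_i > beta, where
   SINR_i = g i i / (N0 + sum_{k in S, k <> i} g k i); written multiplied out
   (denominator positive case identical; denominator 0 means SINR = +infinity). *)
Definition success (R : realType) (n : nat) (N0 beta : R)
  (g : 'I_n -> 'I_n -> R) (S : {set 'I_n}) (i : 'I_n) : bool :=
  (i \in S) && (beta * (N0 + \sum_(k in S | k != i) g k i) < g i i).

Definition throughput (R : realType) (n : nat) (N0 beta : R)
  (g : 'I_n -> 'I_n -> R) (S : {set 'I_n}) : nat :=
  #|[set i | success N0 beta g S i]|.

Definition is_topk (R : realType) (n : nat) (g : 'I_n -> R) (k : nat)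
  (S : {set 'I_n}) : Prop :=
  #|S| = k /\ (forall i j, i \in S -> j \notin S -> g j <= g i).

(* Main.v *)
Require Import Defs.
From HB Require Import structures.
From mathcomp Require Import all_boot all_order all_algebra.
From mathcomp Require Import all_classical all_reals all_analysis.
From mathcomp Require Import measurable_realfun ring lra.
Import Order.TTheory GRing.Theory Num.Theory.
Import numFieldNormedType.Exports.
Local Open Scope classical_set_scope.
Local Open Scope ring_scope.

(** Let [r = n^(1/(1+alpha))], let [U] be the set of pairs whose direct link
    exceeds [x = b r - 1], where [b = 1 + 16 beta], and let
    [lam = n (1+x)^(-alpha) = b^(-alpha) r] be the mean of [#|U|].  By Chebyshev,
    [lam/2 <= #|U| <= 2 lam] with high probability, so the top [k = lam/2] pairs
    lie in [U], and their interference is at most that caused by all of [U].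

    The variable [Y_li = #{j < n | j < gam_li}] dominates [gam_li] as soon as
    [gam_li <= n], which holds for all [l, i] outside an event of probability
    [n^2 (1+n)^(-alpha)], a null sequence because [alpha > 2].  It has mean
    [m <= 2] and second moment at most [2 (1 + ln n)].  Since the direct links are
    independent of the cross links, the expectation of
    [sum_(i in U) (sum_(l in U, l != i) (Y_li - m))^2] is at most
    [lam^2 E(Y^2)], and each pair of [U] with interference above [8 lam <= x/beta - N0]
    contributes at least [16 lam^2] to it; hence with high probability fewer than
    [k/2] such pairs exist.

    Only finitely many thresholds of each [gam_ij] matter, so all expectations
    are finite sums over a product of finite types. *)

(** * Means over finite weighted sets *)

Section FiniteMean.
Context {R : realType} {V : finType}.
Implicit Types (w f g : V -> R).

Definition fmean w (f : V -> R) : R := \sum_v w v * f v.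

Lemma fmeanD w f g : fmean w (fun v => f v + g v) = fmean w f + fmean w g.
Proof. by rewrite -big_split /=; apply: eq_bigr => v _; rewrite mulrDr. Qed.

Lemma fmeanZ w c f : fmean w (fun v => c * f v) = c * fmean w f.
Proof. by rewrite mulr_sumr; apply: eq_bigr => v _; rewrite mulrCA. Qed.

Lemma fmean_sum w (J : Type) (s : seq J) (Q : pred J) (f : J -> V -> R) :
  fmean w (fun v => \sum_(j <- s | Q j) f j v) = \sum_(j <- s | Q j) fmean w (f j).
Proof. by rewrite exchange_big; apply: eq_bigr => v _; rewrite mulr_sumr. Qed.

Lemma ler_fmean w f g : (forall v, 0 <= w v) -> (forall v, f v <= g v) ->
  fmean w f <= fmean w g.
Proof. by move=> w0 fg; apply: ler_sum => v _; apply: ler_wpM2l. Qed.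

Lemma eq_fmean w f g : (forall v, f v = g v) -> fmean w f = fmean w g.
Proof. by move=> fg; apply: eq_bigr => v _; rewrite fg. Qed.

End FiniteMean.

(** Distributivity turns the sum over all functions into a product of sums. Coordinates outside [s]
    contribute their total mass 1, and [uniq s] ensures that each coordinate of [s] occurs once. *)
Lemma fmean_prod {R : realType} {I V : finType} (W : I -> V -> R) (f : I -> V -> R) (s : seq I) :
  (forall p, fmean (W p) (fun=> 1) = 1) -> uniq s ->
  fmean (fun x : {ffun I -> V} => \prod_p W p (x p))
        (fun x => \prod_(p <- s) f p (x p)) =
  \prod_(p <- s) fmean (W p) (f p).
Proof.
move=> W1 us; rewrite [RHS]big_uniq//= [RHS]big_mkcond/=.
transitivity (\prod_p \sum_v W p v * (if p \in s then f p v else 1)).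
  rewrite bigA_distr_bigA/=; apply: eq_bigr => x _.
  rewrite [X in _ * X]big_uniq//= [X in _ * X]big_mkcond/= -big_split/=.
  by apply: eq_bigr => p _; case: ifP.
apply: eq_bigr => p _; case: ifP => // _; exact: W1.
Qed.

(** * Random variables with finitely many values *)

Section FiniteValued.
Context {d : measure_display} {T : measurableType d}.

(** The event is a finite union of finite intersections of fibres, so [Q] may be an arbitrary
    proposition. *)
Lemma measurable_finite_family (I V : finType) (X : I -> T -> V) (Q : {ffun I -> V} -> Prop) :
  (forall i v, measurable [set t | X i t = v]) ->
  measurable [set t | Q [ffun i => X i t]].
Proof.
move=> mX.
have -> : [set t | Q [ffun i => X i t]] =
    \bigcup_(x in [set x : {ffun I -> V} | Q x]) \bigcap_(i in [set: I]) [set t | X i t = x i].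
  apply/seteqP; split => t /=.
    by move=> Qt; exists [ffun i => X i t] => // i _ /=; rewrite ffunE.
  case=> x /= Qx xt; suff -> : [ffun i => X i t] = x by [].
  by apply/ffunP => i; rewrite ffunE; apply: xt.
apply: fin_bigcup_measurable => [|x _]; first exact: finite_finset.
by apply: fin_bigcap_measurable => // ; exact: finite_finset.
Qed.

Context {R : realType}.

Lemma probability_finite (P : probability T R) (V : finType) (D : T -> V) (Q : pred V) :
  (forall v, measurable [set t | D t = v]) ->
  fine (P [set t | Q (D t)]) = fmean (fun v => fine (P [set t | D t = v])) (fun v => (Q v)%:R).
Proof.
move=> mD.
have -> : [set t | Q (D t)] = \bigcup_(v in [set` enum Q]) [set t | D t = v].
  apply/seteqP; split => t /=; first by move=> Qt; exists (D t) => //=; rewrite mem_enum.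
  by case=> v /=; rewrite mem_enum => Qv ->.
rewrite measure_fin_bigcup//; last by move=> v v' _ _ [t [/= <- <-]].
rewrite -fsbig_seq ?enum_uniq// -sum_fine; last by move=> v _; exact: fin_num_measure.
rewrite big_enum/= /fmean [LHS]big_mkcond; apply: eq_bigr => v _.
by rewrite unfold_in; case: (Q v); rewrite ?mulr1 ?mulr0.
Qed.

End FiniteValued.

(** * Deterministic lower bound on the throughput *)

Section Deterministic.
Context {R : realType} {n : nat}.
Implicit Types (g Y : 'I_n -> 'I_n -> R) (S : {set 'I_n}).

(** If some [i] in [S] had [h i <= x], maximality would put every index above [x] into [S]; these
    would form a proper subset of [S], hence number fewer than [k]. *)
Lemma is_topk_subset (h : 'I_n -> R) (k : nat) S (x : R) :
  is_topk h k S -> (k <= #|[set i | (x < h i)%R]%SET|)%N -> S \subset [set i | x < h i]%SET.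
Proof.
move=> [cS Stop] kU; apply/fintype.subsetP => i iS; rewrite inE ltNge; apply/negP => hix.
suff : (#|[set i | (x < h i)%R]%SET| < k)%N by rewrite ltnNge kU.
rewrite -cS; apply: proper_card; apply/properP; split.
  apply/fintype.subsetP => j; rewrite inE => xj; apply/negPn/negP => jS.
  by have := le_trans (Stop _ _ iS jS) hix; rewrite leNgt xj.
by exists i => //; rewrite inE ltNge hix.
Qed.

Lemma throughputE (N0 beta : R) g S :
  throughput N0 beta g S = #|[set i | success N0 beta g S i]%SET|.
Proof. by apply: eq_card => i; rewrite [RHS]inE; apply/idP/idP; rewrite inE. Qed.

Lemma ler_count_lt (z : R) (m : nat) : z <= m%:R -> z <= \sum_(j < m) (j%:R < z)%R%:R.
Proof.
elim: m => [|m IH] zm; first by rewrite big_ord0.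
have [zm'|mz] := leP z m%:R.
  by rewrite big_ord_recr/=; apply: (le_trans (IH zm')); rewrite lerDl ler0n.
(* Here [m < z <= m + 1], so each of the [m + 1] thresholds lies below [z] and the count is exactly
   [m + 1]. *)
apply: (le_trans zm); rewrite -[leLHS]mulr1 mulr_natl -[in leLHS](card_ord m.+1) -sumr_const.
apply: ler_sum => j _; suff -> : j%:R < z by [].
by apply: le_lt_trans mz; rewrite ler_nat -ltnS.
Qed.

Lemma throughput_ge g Y (k : nat) (x lam m beta N0 : R) S :
  (0 < k)%N -> 0 < lam -> 0 <= beta -> 0 <= m <= 2 -> k%:R <= lam / 2 ->
  beta * (N0 + 8 * lam) <= x ->
  (forall i j, 0 <= Y i j) -> (forall i j, g i j <= Y i j) ->
  4 * ((\sum_i (x < g i i)%R%:R - lam) ^+ 2) < lam ^+ 2 ->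
  \sum_i (x < g i i)%R%:R * (\sum_(l | l != i) (x < g l l)%R%:R * (Y l i - m)) ^+ 2
    < 8 * k%:R * lam ^+ 2 ->
  is_topk (fun i => g i i) k S ->
  k%:R / 2 <= (throughput N0 beta g S)%:R :> R.
Proof.
move=> k0 lam0 b0 /andP[m0 m2] klam hx Y0 gY hcount hD topS.
set U := [set i | x < g i i]%SET.
have cU : \sum_i (x < g i i)%R%:R = #|U|%:R :> R.
  by rewrite -natr_sum -sum1dep_card; congr _%:R; rewrite [RHS]big_mkcond; apply: eq_bigr => i _; case: (x < _).
rewrite cU in hcount.
have [U1 U2] : lam / 2 <= #|U|%:R /\ #|U|%:R <= 2 * lam by split; nra.
have SU : S \subset U.
  by apply: (@is_topk_subset (fun i => g i i) k S x topS); rewrite -(ler_nat R); apply: le_trans klam U1.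
have cS : #|S| = k by case: topS.
pose Z i := \sum_(l | l != i) (x < g l l)%R%:R * (Y l i - m).
(* The active pairs with large centred interference; it is shown that every failing pair of [S]
   belongs to [B], and that [B] has fewer than [k / 2] elements. *)
pose B := [set i in S | 4 * lam < Z i]%SET.
have BT : (k <= #|B| + throughput N0 beta g S)%N.
  rewrite -cS throughputE.
  rewrite -(cardsID [set i | success N0 beta g S i]%SET S) addnC leq_add//; last first.
    by apply: subset_leq_card; exact: subsetIr.
  apply: subset_leq_card; apply/fintype.subsetP => i.
  rewrite !inE => /andP[+ iS]; rewrite iS/= /success iS/=.
  (* If [Z i <= 4 * lam], the interference from [U] is at most [Z i + m * #|U| <= 4 * lam + 2 * (2 *
     lam)], so [i] succeeds. *)
  apply: contraNT; rewrite -leNgt => Zi.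
  have xi : x < g i i by have /fintype.subsetP/(_ _ iS) := SU; rewrite inE.
  apply: le_lt_trans xi; apply: le_trans hx.
  apply: ler_wpM2l => //; rewrite lerD2l.
  have : \sum_(l | l != i) (x < g l l)%R%:R * Y l i <= 8 * lam.
    have -> : \sum_(l | l != i) (x < g l l)%R%:R * Y l i = Z i + m * \sum_(l | l != i) (x < g l l)%R%:R.
      rewrite mulr_sumr -big_split/=; apply: eq_bigr => l _; ring.
    have : \sum_(l | l != i) (x < g l l)%R%:R <= #|U|%:R :> R.
      by rewrite -cU [leRHS](bigD1 i)//= lerDr ler0n.
    have : 0 <= \sum_(l | l != i) (x < g l l)%R%:R :> R by apply: sumr_ge0 => l _; rewrite ler0n.
    nra.
  apply: le_trans.
  rewrite big_mkcondl/=; apply: ler_sum => l li; case: ifPn => lS.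
    by have /fintype.subsetP/(_ _ lS) := SU; rewrite inE => ->; rewrite mul1r.
  by rewrite mulr_ge0.
have BD : #|B|%:R * (16 * lam ^+ 2) <= \sum_i (x < g i i)%R%:R * (Z i) ^+ 2.
  rewrite mulr_natl -sumr_const big_mkcond/=; apply: ler_sum => i _.
  case: ifPn => [|_]; last by rewrite mulr_ge0// sqr_ge0.
  rewrite inE => /andP[iS Zi]; have /fintype.subsetP/(_ _ iS) := SU; rewrite inE => ->.
  rewrite mul1r; nra.
have lam2 : 0 < lam ^+ 2 by rewrite exprn_gt0.
have : #|B|%:R < k%:R / 2 :> R.
  have := le_lt_trans BD hD; rewrite [X in X < _ -> _]mulrA -/(lam ^+ 2) ltr_pM2r//; lra.
move: BT; rewrite -(ler_nat R) natrD; lra.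
Qed.

End Deterministic.

(** * Second moments under a product weight *)

(** Orthogonality kills the off-diagonal terms of the expanded square. The factor [c] later carries
    the indicator that the receiver's own direct link is strong. *)
Lemma fmean_sqr_sum {R : realType} {V J : finType} (w c : V -> R) (Q : pred J) (F : J -> V -> R) :
  (forall l l', Q l -> Q l' -> l != l' -> fmean w (fun v => c v * (F l v * F l' v)) = 0) ->
  fmean w (fun v => c v * (\sum_(l | Q l) F l v) ^+ 2) =
  \sum_(l | Q l) fmean w (fun v => c v * F l v ^+ 2).
Proof.
move=> orth.
transitivity (fmean w (fun v => \sum_(l | Q l) \sum_(l' | Q l') c v * (F l v * F l' v))).
  apply: eq_fmean => v; rewrite expr2 mulr_suml mulr_sumr; apply: eq_bigr => l _.
  by rewrite !mulr_sumr.
rewrite fmean_sum; apply: eq_bigr => l Ql.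
rewrite fmean_sum (bigD1 l)//= big1 ?addr0// => l' /andP[Ql' l'l].
by rewrite orth// eq_sym.
Qed.

Section Moments.
Context {R : realType} {V : finType} (n : nat) (W : 'I_n * 'I_n -> V -> R).
Hypothesis W0 : forall p v, 0 <= W p v.
Hypothesis W1 : forall p, fmean (W p) (fun=> 1) = 1.

Let Pr (x : {ffun 'I_n * 'I_n -> V}) : R := \prod_p W p (x p).

Lemma product_weight_ge0 x : 0 <= Pr x.
Proof. by apply: prodr_ge0. Qed.

Lemma fmean_product_weight1 : fmean Pr (fun=> 1) = 1.
Proof.
have := @fmean_prod R _ V W (fun _ _ => 1) [::] W1 isT; rewrite [RHS]big_nil => E.
by rewrite -[RHS]E; apply: eq_fmean => x; rewrite big_nil.
Qed.

Lemma fmean_coord p (f : V -> R) : fmean Pr (fun x => f (x p)) = fmean (W p) f.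
Proof.
have := @fmean_prod R _ V W (fun=> f) [:: p] W1 isT; rewrite [RHS]big_seq1 => <-.
by apply: eq_fmean => x; rewrite big_seq1.
Qed.

Variables (u : V -> bool) (q : R).
Hypothesis uq : forall p, fmean (W p) (fun v => (u v)%:R) = q.

(** The variance of a sum of [n] independent Bernoulli variables is [n q (1 - q)]. *)
Lemma fmean_count_sqr :
  fmean Pr (fun x => (\sum_i (u (x (i, i)))%:R - n%:R * q) ^+ 2) <= n%:R * q.
Proof.
have uq0 p : fmean (W p) (fun v => (u v)%:R - q) = 0.
  transitivity (fmean (W p) (fun v => (u v)%:R + (- q) * 1)).
    by apply: eq_fmean => v; rewrite mulr1.
  by rewrite fmeanD fmeanZ W1 uq mulr1 subrr.
have q0 : 0 <= n%:R * q.
  rewrite mulr_natl -[n in _ *+ n]card_ord -sumr_const.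
  apply: sumr_ge0 => i _; rewrite -(uq (i, i)).
  by apply: sumr_ge0 => v _; rewrite mulr_ge0// ler0n.
apply: (@le_trans _ _ (fmean Pr (fun x => 1 * (\sum_i ((u (x (i, i)))%:R - q)) ^+ 2))).
  rewrite le_eqVlt; apply/orP; left; apply/eqP; apply: eq_fmean => x.
  by rewrite mul1r sumrB sumr_const card_ord mulr_natl.
rewrite fmean_sqr_sum => [|i j _ _ ij]; last first.
  transitivity (\prod_(p <- [:: (i, i); (j, j)]) fmean (W p) (fun v => (u v)%:R - q)).
    rewrite -fmean_prod//=; last by rewrite inE andbT; apply: contra ij => /eqP[->].
    by apply: eq_fmean => x; rewrite mul1r !big_cons big_nil mulr1.
  by rewrite big_cons uq0 mul0r.
rewrite mulr_natl -[n in _ *+ n]card_ord -sumr_const; apply: ler_sum => i _.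
rewrite (fmean_coord (i, i) (fun v => 1 * ((u v)%:R - q) ^+ 2)).
(* Since [u v] is 0 or 1, its square is itself and the squared deviation is affine in [u v]. *)
apply: (@le_trans _ _ (fmean (W (i, i)) (fun v => (1 - 2 * q) * (u v)%:R + q ^+ 2 * 1))).
  apply: ler_fmean => // v; case: (u v) => /=; nra.
rewrite fmeanD !fmeanZ W1 uq; nra.
Qed.

Variables (Y : V -> R) (m v2 : R).
Hypothesis Ym : forall p, fmean (W p) Y = m.
Hypothesis Yv : forall p, fmean (W p) (fun v => Y v ^+ 2) <= v2.

Lemma fmean_interference_sqr :
  fmean Pr (fun x => \sum_i (u (x (i, i)))%:R *
     (\sum_(l | l != i) (u (x (l, l)))%:R * (Y (x (l, i)) - m)) ^+ 2)
  <= (n%:R * q) ^+ 2 * v2.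
Proof.
have Ym0 p : fmean (W p) (fun v => Y v - m) = 0.
  transitivity (fmean (W p) (fun v => Y v + (- m) * 1)).
    by apply: eq_fmean => v; rewrite mulr1.
  by rewrite fmeanD fmeanZ W1 Ym mulr1 subrr.
have Yvar p : fmean (W p) (fun v => (Y v - m) ^+ 2) <= v2.
  apply: (@le_trans _ _ (fmean (W p) (fun v => Y v ^+ 2 + (((- 2) * m) * Y v + m ^+ 2 * 1)))).
    rewrite le_eqVlt; apply/orP; left; apply/eqP; apply: eq_fmean => v; ring.
  by rewrite !fmeanD !fmeanZ W1 Ym; have := Yv p; nra.
rewrite fmean_sum.
have -> : (n%:R * q) ^+ 2 * v2 = \sum_(i < n) \sum_(l < n) q * q * v2.
  rewrite !sumr_const card_ord -[RHS]mulr_natl -[in RHS]mulr_natr; ring.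
apply: ler_sum => i _.
rewrite fmean_sqr_sum => [|l l' li l'i ll']; last first.
  (* The cross term involves five distinct coordinates, two cross links and three direct links; the
     centred factor at [(l, i)] has mean zero. *)
  transitivity (\prod_(p <- [:: (l, i); (l', i); (i, i); (l, l); (l', l')])
     fmean (W p) (fun v => if p.1 == p.2 then (u v)%:R else Y v - m)).
    rewrite -fmean_prod//=; last first.
      rewrite !inE !xpair_eqE !eqxx !andbT (negbTE li) (negbTE l'i) (negbTE ll').
      by rewrite ![i == _]eq_sym (negbTE li) (negbTE l'i) ?andbF.
    apply: eq_fmean => x; rewrite !big_cons big_nil mulr1 /= !eqxx (negbTE li) (negbTE l'i).
    ring.
  by rewrite big_cons/= (negbTE li) Ym0 mul0r.
(* Each [l != i] contributes [q * q] times a variance; the missing term [l = i] is 0, so the sum may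
   run over all [l]. *)
rewrite [leLHS]big_mkcond/=; apply: ler_sum => l _.
have q0 : 0 <= q.
  by rewrite -(uq (i, i)); apply: sumr_ge0 => v _; rewrite mulr_ge0// ler0n.
have v20 : 0 <= v2.
  apply: le_trans (Yv (i, i)); apply: sumr_ge0 => v _; by rewrite mulr_ge0// sqr_ge0.
case: ifPn => li; last by rewrite !mulr_ge0.
have -> : fmean Pr (fun x => (u (x (i, i)))%:R *
     ((u (x (l, l)))%:R * (Y (x (l, i)) - m)) ^+ 2) =
   \prod_(p <- [:: (i, i); (l, l); (l, i)])
     fmean (W p) (fun v => if p.1 == p.2 then (u v)%:R else (Y v - m) ^+ 2).
  rewrite -fmean_prod//=; last first.
    by rewrite !inE !xpair_eqE !eqxx !andbT ![i == _]eq_sym (negbTE li).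
  apply: eq_fmean => x; rewrite !big_cons big_nil mulr1 /= !eqxx (negbTE li).
  by case: (u (x (i, i))); case: (u (x (l, l))); rewrite /= ?mul0r ?mul1r// expr2 mul0r.
rewrite !big_cons big_nil mulr1/= !eqxx (negbTE li) !uq -mulrA.
by do 2!(apply: ler_wpM2l => //).
Qed.

End Moments.

(** * Markov's inequality and elementary sums *)

(** Pointwise, [1 - M v] is at most the indicator of [M v < 1]. With the threshold normalised to 1,
    several bad events can be summed into a single [M]. *)
Lemma fmean_markov {R : realType} {V : finType} (w M : V -> R) :
  (forall v, 0 <= w v) -> fmean w (fun=> 1) = 1 -> (forall v, 0 <= M v) ->
  1 - fmean w M <= fmean w (fun v => (M v < 1)%R%:R).
Proof.
move=> w0 w1 M0.
have -> : 1 - fmean w M = fmean w (fun v => 1 + (-1) * M v).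
  by rewrite fmeanD fmeanZ w1 mulN1r.
apply: ler_fmean => // v; have := M0 v; have [/=|/=] := ltP (M v) 1; lra.
Qed.

Lemma sum_inv_sqr_le2 (R : realType) (n : nat) :
  \sum_(j < n) (j.+1%:R ^+ 2)^-1 <= 2 :> R.
Proof.
case: n => [|n]; first by rewrite big_ord0.
(* The stronger bound telescopes, because [1 / (y + 1)^2 <= 1 / y - 1 / (y + 1)]. *)
suff : \sum_(j < n.+1) (j.+1%:R ^+ 2)^-1 <= 2 - n.+1%:R^-1 :> R.
  by move=> /le_trans; apply; rewrite gerBl invr_ge0.
elim: n => [|n IH]; first by rewrite big_ord_recr big_ord0/= expr1n invr1; lra.
rewrite big_ord_recr/=; apply: (le_trans (lerD IH (lexx _))).
have n0 : 0 < n.+1%:R :> R by [].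
have -> : n.+2%:R = n.+1%:R + 1 :> R by rewrite natr1.
move: (n.+1%:R : R) n0 => y y0.
have -> : 2 - (y + 1)^-1 = 2 - y^-1 + (y * (y + 1))^-1.
  by field; rewrite !gt_eqF// addr_gt0.
by rewrite lerD2l lef_pV2 ?posrE ?mulr_gt0 ?exprn_gt0 ?addr_gt0//; nra.
Qed.

Lemma sum_inv_le_ln (R : realType) (n : nat) : (0 < n)%N ->
  \sum_(j < n) j.+1%:R^-1 <= 1 + ln n%:R :> R.
Proof.
case: n => // n _; elim: n => [|n IH]; first by rewrite big_ord_recr big_ord0/= invr1 ln1; lra.
rewrite big_ord_recr/=; apply: (le_trans (lerD IH (lexx _))).
rewrite -addrA lerD2l -lerBrDl.
have n1 : 0 < n.+1%:R :> R by []. have n2 : 0 < n.+2%:R :> R by [].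
(* In this form the increment bound is [ln (1 + t) <= t] at [t = - 1 / (n + 2)]. *)
have -> : ln n.+2%:R - ln n.+1%:R = - ln (1 + - n.+2%:R^-1) :> R.
  rewrite -ln_div ?posrE// -lnV ?posrE; last first.
    by rewrite subr_gt0 invf_lt1// ltr1n.
  congr ln; have -> : n.+2%:R = n.+1%:R + 1 :> R by rewrite natr1.
  by field; rewrite gt_eqF//= natr1 gt_eqF.
by rewrite lerNr; apply: le_ln1Dx; rewrite ltrN2 invf_lt1// ltr1n.
Qed.

(** Raising a partial count [s <= n] by one increases its square by [2 s + 1 <= 2 (n + 1)]. This
    reduces second moments to tail probabilities. *)
Lemma sqr_count_le (R : realType) (n : nat) (b : nat -> bool) :
  (\sum_(j < n) (b j)%:R) ^+ 2 <= \sum_(j < n) 2 * j.+1%:R * (b j)%:R :> R.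
Proof.
elim: n => [|n IH]; first by rewrite !big_ord0 expr2 mul0r.
rewrite !big_ord_recr/=.
have : \sum_(j < n) (b j)%:R <= n%:R :> R.
  rewrite -[leRHS]mulr1 mulr_natl -[in leRHS](card_ord n) -sumr_const.
  by apply: ler_sum => j _; case: (b j).
have : 0 <= \sum_(j < n) (b j)%:R :> R by apply: sumr_ge0 => j _; rewrite ler0n.
rewrite -natr1; move: IH; case: (b n) => /=; nra.
Qed.

(** * Probability bound for a network of fixed size *)

Section OneNetwork.
Context {R : realType} {d : measure_display} {T : measurableType d}.
Context (P : probability T R) {n : nat} (g : 'I_n -> 'I_n -> T -> R) (alpha : R).
Hypothesis alpha2 : 2 < alpha.
Hypothesis mg : forall i j, measurable_fun setT (g i j).
Hypothesis cdf : forall i j x, P [set t | g i j t <= x] = (pareto_cdf alpha x)%:E.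
Hypothesis indep : mutually_independent P (fun p : 'I_n * 'I_n => g p.1 p.2).

(** The event is determined by finitely many booleans: the comparisons between direct links, and the
    success of each [i] under each active set. *)
Lemma measurable_throughput_event (N0 beta y : R) (k : nat) :
  measurable [set t | forall S : {set 'I_n}, is_topk (fun i => g i i t) k S ->
     y <= (throughput N0 beta (fun i j => g i j t) S)%:R].
Proof.
pose X (a : ('I_n * 'I_n) + ({set 'I_n} * 'I_n)) t : bool :=
  match a with
  | inl p => g p.2 p.2 t <= g p.1 p.1 t
  | inr p => success N0 beta (fun i j => g i j t) p.1 p.2
  end.
pose Q (b : {ffun ('I_n * 'I_n) + ({set 'I_n} * 'I_n) -> bool}) :=
  forall S : {set 'I_n},
    #|S| = k /\ (forall i j, i \in S -> j \notin S -> b (inl (i, j))) ->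
    y <= #|[set i | b (inr (S, i))]%SET|%:R.
rewrite [X in measurable X](_ : _ = [set t | Q [ffun a => X a t]]).
  apply: measurable_finite_family => a v.
  suff mX : measurable_fun setT (X a).
    by rewrite -[X in measurable X]setTI; exact: (mX measurableT [set v]).
  case: a => -[i j] /=; first exact: measurable_fun_ler.
  rewrite /X /success/=; case: (j \in i) => /=; last exact: measurable_cst.
  apply: measurable_fun_ltr => //; apply: measurable_funM => //.
  apply: measurable_funD => //.
  under eq_fun do rewrite big_mkcond/=.
  by apply: measurable_sum => l; case: (_ && _) => //; exact: measurable_cst.
apply/seteqP; split => t /= H S [cS hS].
  rewrite (_ : #|_| = throughput N0 beta (fun i j => g i j t) S).
    by apply: H; split => // i j iS jS; have := hS i j iS jS; rewrite ffunE.
  by rewrite throughputE; apply: eq_card => i; rewrite !inE ffunE.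
rewrite throughputE.
rewrite (_ : #|_| = #|[set i | [ffun a => X a t] (inr (S, i))]%SET|).
  by apply: H; split => // i j iS jS; rewrite ffunE; exact: hS.
by apply: eq_card => i; rewrite !inE ffunE.
Qed.

Lemma pareto_tail i j x : 0 <= x -> fine (P [set t | x < g i j t]) = (1 + x) `^ (- alpha).
Proof.
move=> x0.
have mA : measurable [set t | g i j t <= x].
  rewrite -[X in measurable X]setTI.
  have mB : measurable_fun setT (fun t => g i j t <= x) by exact: measurable_fun_ler.
  exact: (mB measurableT [set true]).
have -> : [set t | x < g i j t] = ~` [set t | g i j t <= x].
  by apply/seteqP; split => t /=; rewrite ltNge => /negP.
rewrite probability_setC// cdf /pareto_cdf ltNge x0/=; ring.
Qed.

Variable x : R.
Hypothesis x0 : 0 <= x.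

(* The last index carries the direct-link threshold, index [j <= n] the level [j]. *)
Definition level (j : 'I_n.+2) : R := if j == ord_max then x else j%:R.
Definition levels_below (z : R) : {ffun 'I_n.+2 -> bool} := [ffun j => level j < z].
Definition levels_law (p : 'I_n * 'I_n) (v : {ffun 'I_n.+2 -> bool}) : R :=
  fine (P [set t | levels_below (g p.1 p.2 t) = v]).

Lemma measurable_levels_below v : measurable [set z : R | levels_below z = v].
Proof.
apply: (@measurable_finite_family _ _ _ _ (fun j (z : R) => level j < z) (fun w => w = v)).
move=> j b.
rewrite -[X in measurable X]setTI.
have mB : measurable_fun setT (fun z : R => level j < z) by exact: measurable_fun_ltr.
exact: (mB measurableT [set b]).
Qed.

Lemma measurable_levels p v : measurable [set t | levels_below (g p.1 p.2 t) = v].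
Proof.
rewrite -[X in measurable X]setTI.
exact: (mg p.1 p.2 measurableT _ (measurable_levels_below v)).
Qed.

Lemma levels_law_ge0 p v : 0 <= levels_law p v.
Proof. exact: fine_ge0. Qed.

Lemma levels_law1 p : fmean (levels_law p) (fun=> 1) = 1.
Proof.
transitivity (fine (P [set t | xpredT (levels_below (g p.1 p.2 t))])).
  by rewrite (probability_finite P _ (fun t => levels_below (g p.1 p.2 t)) xpredT)//; exact: measurable_levels.
by rewrite (_ : [set _ | _] = setT) ?probability_setT//; apply/seteqP.
Qed.

Lemma level_ge0 j : 0 <= level j.
Proof. by rewrite /level; case: ifP. Qed.

Lemma fmean_level p j :
  fmean (levels_law p) (fun v => (v j)%:R) = (1 + level j) `^ (- alpha).
Proof.
rewrite -(probability_finite P _ (fun t => levels_below (g p.1 p.2 t)) (fun v => v j)); last first.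
  exact: measurable_levels.
rewrite -(pareto_tail p.1 p.2 _ (level_ge0 j)); congr (fine (P _)).
by apply/seteqP; split => t /=; rewrite ffunE.
Qed.

(** Independence of the channel powers enters here: the mass of each joint record of levels factors
    over the links. *)
Lemma joint_law (A : pred {ffun 'I_n * 'I_n -> {ffun 'I_n.+2 -> bool}}) :
  fine (P [set t | A [ffun p => levels_below (g p.1 p.2 t)]]) =
  fmean (fun w : {ffun 'I_n * 'I_n -> {ffun 'I_n.+2 -> bool}} => \prod_p levels_law p (w p))
    (fun w => (A w)%:R).
Proof.
rewrite (probability_finite P _ (fun t => [ffun p => levels_below (g p.1 p.2 t)])); last first.
  move=> w; apply: (measurable_finite_family _ _ (fun p t => levels_below (g p.1 p.2 t)) (fun w' => w' = w)).
  exact: measurable_levels.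
apply: eq_bigr => w _; congr (_ * _).
rewrite -(indep (fun p => [set z | levels_below z = w p])); last first.
  by move=> p; exact: measurable_levels_below.
congr (fine (P _)); apply/seteqP; split => t /=.
  by move=> <- p _ /=; rewrite ffunE.
by move=> H; apply/ffunP => p; rewrite ffunE; exact: H.
Qed.

(** At [levels_below z] with [z >= 0] this is the ceiling of [z] capped at [n], the dominating
    variable [Y]. *)
Definition unit_levels (v : {ffun 'I_n.+2 -> bool}) : R :=
  \sum_(j < n) (v (inord j))%:R.

Lemma level_inord (j : nat) : (j <= n)%N -> level (inord j) = j%:R.
Proof.
move=> jn; rewrite /level -val_eqE/= inordK; last by rewrite ltnS leqW.
by rewrite ltn_eqF.
Qed.

Lemma level_max : level ord_max = x. Proof. by rewrite /level eqxx. Qed.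

Lemma unit_levels_ge0 v : 0 <= unit_levels v.
Proof. by apply: sumr_ge0 => j _; rewrite ler0n. Qed.

Lemma le_unit_levels (z : R) : z <= n%:R -> z <= unit_levels (levels_below z).
Proof.
move=> zn; apply: (le_trans (ler_count_lt _ _ zn)); apply: ler_sum => j _.
by rewrite ffunE level_inord// ltnW.
Qed.

Lemma fmean_unit_levels p :
  fmean (levels_law p) unit_levels = \sum_(j < n) j.+1%:R `^ (- alpha).
Proof.
rewrite /unit_levels fmean_sum; apply: eq_bigr => j _.
by rewrite fmean_level level_inord 1?ltnW// nat1r.
Qed.

Lemma powR_nat_le2 (j : nat) : j.+1%:R `^ (- alpha) <= (j.+1%:R ^+ 2)^-1 :> R.
Proof.
rewrite powRN lef_pV2 ?posrE ?powR_gt0 ?exprn_gt0//.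
rewrite -powR_mulrn//; apply: ler_powR; last exact: ltW.
by rewrite ler1n.
Qed.

(** The link exceeds [j] with probability at most [(j + 1)^(-2)], so the weights [2 (j + 1)] of
    [sqr_count_le] leave a harmonic sum. *)
Lemma fmean_unit_levels_sqr p :
  fmean (levels_law p) (fun v => unit_levels v ^+ 2) <= 2 * \sum_(j < n) j.+1%:R^-1.
Proof.
apply: (@le_trans _ _ (fmean (levels_law p)
    (fun v => \sum_(j < n) 2 * j.+1%:R * (v (inord j))%:R))).
  apply: ler_fmean => [v|v]; first exact: levels_law_ge0.
  exact: (@sqr_count_le R n (fun j => v (inord j))).
rewrite fmean_sum mulr_sumr; apply: ler_sum => j _.
rewrite fmeanZ fmean_level level_inord 1?ltnW// nat1r -mulrA ler_pM2l//.
apply: (le_trans (ler_wpM2l _ (powR_nat_le2 j))) => //.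
by rewrite expr2 invfM mulrA mulfV ?mul1r.
Qed.

(** The three error terms come from the count of strong direct links, their interference, and the
    event that some link exceeds [n]. *)
Lemma probability_throughput_ge (beta N0 y : R) (k : nat) :
  let lam := n%:R * (1 + x) `^ (- alpha) in
  0 < beta -> 0 < lam -> (0 < k)%N -> k%:R <= lam / 2 -> y <= k%:R / 2 ->
  beta * (N0 + 8 * lam) <= x ->
  1 - (4 / lam + (\sum_(j < n) j.+1%:R^-1) / (4 * k%:R)
       + n%:R ^+ 2 * n.+1%:R `^ (- alpha))
  <= fine (P [set t | forall S : {set 'I_n}, is_topk (fun i => g i i t) k S ->
     y <= (throughput N0 beta (fun i j => g i j t) S)%:R]).
Proof.
move=> lam b0 lam0 k0 klam yk hx.
pose m := \sum_(j < n) j.+1%:R `^ (- alpha) : R.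
pose u (v : {ffun 'I_n.+2 -> bool}) := v ord_max.
pose Pr (w : {ffun 'I_n * 'I_n -> {ffun 'I_n.+2 -> bool}}) := \prod_p levels_law p (w p).
pose M1 (w : {ffun 'I_n * 'I_n -> {ffun 'I_n.+2 -> bool}}) : R :=
  (\sum_i (u (w (i, i)))%:R - lam) ^+ 2.
pose M2 (w : {ffun 'I_n * 'I_n -> {ffun 'I_n.+2 -> bool}}) : R :=
  \sum_i (u (w (i, i)))%:R *
     (\sum_(l | l != i) (u (w (l, l)))%:R * (unit_levels (w (l, i)) - m)) ^+ 2.
pose M3 (w : {ffun 'I_n * 'I_n -> {ffun 'I_n.+2 -> bool}}) : R :=
  \sum_p (w p (inord n))%:R.
(* The summands are nonnegative, so [M w < 1] forces each below 1, which gives exactly the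
   hypotheses of [throughput_ge]. *)
pose M w := 4 / lam ^+ 2 * M1 w + (8 * k%:R * lam ^+ 2)^-1 * M2 w + M3 w.
have k0R : 0 < k%:R :> R by rewrite ltr0n.
have lam2 : 0 < lam ^+ 2 by rewrite exprn_gt0.
have M10 w : 0 <= M1 w by exact: sqr_ge0.
have M20 w : 0 <= M2 w by apply: sumr_ge0 => i _; rewrite mulr_ge0// sqr_ge0.
have M30 w : 0 <= M3 w by apply: sumr_ge0 => i _.
have c1 : 0 < 4 / lam ^+ 2 by rewrite divr_gt0.
have c2 : 0 < (8 * k%:R * lam ^+ 2)^-1.
  by rewrite invr_gt0; apply: mulr_gt0 => //; exact: mulr_gt0.
have a1 w : 0 <= 4 / lam ^+ 2 * M1 w by apply: mulr_ge0 => //; exact: ltW.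
have a2 w : 0 <= (8 * k%:R * lam ^+ 2)^-1 * M2 w by apply: mulr_ge0 => //; exact: ltW.
have M0 w : 0 <= M w by apply: addr_ge0 => //; exact: addr_ge0.
have uq p : fmean (levels_law p) (fun v => (u v)%:R) = (1 + x) `^ (- alpha).
  by rewrite fmean_level level_max.
have EM : fmean Pr M <= 4 / lam + (\sum_(j < n) j.+1%:R^-1) / (4 * k%:R)
       + n%:R ^+ 2 * n.+1%:R `^ (- alpha).
  rewrite !fmeanD !fmeanZ; apply: lerD; first apply: lerD.
  - have -> : 4 / lam = 4 / lam ^+ 2 * lam by field; rewrite gt_eqF.
    rewrite ler_pM2l//.
    exact: (fmean_count_sqr n levels_law levels_law_ge0 levels_law1 u _ uq).
  - have -> : (\sum_(j < n) j.+1%:R^-1) / (4 * k%:R) =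
       (8 * k%:R * lam ^+ 2)^-1 * (lam ^+ 2 * (2 * \sum_(j < n) j.+1%:R^-1)).
      by field; rewrite !gt_eqF.
    rewrite ler_pM2l//.
    exact: (fmean_interference_sqr n levels_law levels_law_ge0 levels_law1 u _ uq
      unit_levels m _ fmean_unit_levels fmean_unit_levels_sqr).
  - rewrite /M3 fmean_sum le_eqVlt; apply/orP; left; apply/eqP.
    transitivity (\sum_(p : 'I_n * 'I_n) n.+1%:R `^ (- alpha) : R).
      apply: eq_bigr => p _.
      rewrite (fmean_coord n levels_law levels_law1 p (fun v => (v (inord n))%:R)).
      by rewrite fmean_level level_inord// nat1r.
    by rewrite sumr_const card_prod card_ord -[LHS]mulr_natl natrM expr2.
have := fmean_markov Pr M (product_weight_ge0 n levels_law levels_law_ge0)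
  (fmean_product_weight1 n levels_law levels_law1) M0.
rewrite -(joint_law (fun w => M w < 1)) => H.
apply: (@le_trans _ _ (1 - fmean Pr M)); first by rewrite lerD2l lerN2.
have mM : measurable [set t | M [ffun p => levels_below (g p.1 p.2 t)] < 1].
  apply: (measurable_finite_family _ _ (fun p t => levels_below (g p.1 p.2 t)) (fun w => M w < 1)).
  exact: measurable_levels.
have mE := measurable_throughput_event N0 beta y k.
apply: (le_trans H); apply: fine_le; rewrite ?fin_num_measure//.
apply: le_measure; rewrite ?inE//.
move=> t /= Mt S topS; apply: (le_trans yk).
set w := [ffun p => _] in Mt.
have m02 : 0 <= m <= 2.
  rewrite sumr_ge0 => [|j _]; last exact: powR_ge0.
  by apply: le_trans (sum_inv_sqr_le2 R n); apply: ler_sum => j _; exact: powR_nat_le2.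
have [M1t M2t M3t] : [/\ 4 / lam ^+ 2 * M1 w < 1, (8 * k%:R * lam ^+ 2)^-1 * M2 w < 1 & M3 w < 1].
  by move: (a1 w) (a2 w) (M30 w) Mt; rewrite /M => *; split; lra.
have uE i : u (w (i, i)) = (x < g i i t) by rewrite /u !ffunE/= level_max.
apply: (@throughput_ge R n (fun i j => g i j t) (fun i j => unit_levels (w (i, j))) k x lam m) => //.
- exact: ltW.
- by move=> i j; exact: unit_levels_ge0.
(* A single link above [n] would already make the count [M3] at least 1. *)
- move=> i j; rewrite ffunE; apply: le_unit_levels; rewrite leNgt; apply/negP => nij.
  move: M3t; rewrite ltNge => /negP; apply.
  rewrite /M3 (bigD1 (i, j))//= !ffunE level_inord// nij lerDl.
  by apply: sumr_ge0 => p _.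
- move: M1t; rewrite mulrAC ltr_pdivrMr// mul1r /M1.
  by under eq_bigr do rewrite uE.
- move: M2t; rewrite mulrC ltr_pdivrMr; last by rewrite -invr_gt0.
  rewrite mul1r /M2; under eq_bigr do rewrite uE.
  apply: le_lt_trans; rewrite le_eqVlt; apply/orP; left; apply/eqP.
  by apply: eq_bigr => i _; congr (_ * _ ^+ 2); apply: eq_bigr => l _; rewrite uE.
Qed.

End OneNetwork.

(** * Asymptotics in the number of pairs *)

Lemma natr_powR_cvgy (R : realType) (a : R) : 0 < a ->
  n%:R `^ a @[n --> \oo] --> +oo.
Proof.
move=> a0; apply/cvgryPge => A; near=> n.
have : (`|A| + 1) `^ a^-1 <= n%:R by near: n; exact: nbhs_infty_ger.
move=> /(ge0_ler_powR (ltW a0)); rewrite !nnegrE powR_ge0 ler0n => /(_ isT isT).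
rewrite -powRrM mulVf ?gt_eqF// powRr1 ?addr_ge0//; apply: le_trans.
by rewrite -[leLHS]addr0 lerD// ler_norm.
Unshelve. all: by end_near. Qed.

Lemma natr_powRN_cvg0 (R : realType) (a : R) : 0 < a ->
  n%:R `^ (- a) @[n --> \oo] --> (0 : R).
Proof.
move=> a0; under eq_fun do rewrite powRN.
apply/gtr0_cvgV0; last by apply: natr_powR_cvgy.
by exists 1%N => // n /= n1; rewrite powR_gt0// ltr0n.
Qed.

Theorem corollary3 (R : realType) (alpha beta N0 : R) :
  2 < alpha -> 0 < beta -> 0 <= N0 ->
  exists c : R, 0 < c /\
  exists k : nat -> nat, (forall n, (k n <= n)%N) /\
  forall (d : measure_display) (T : measurableType d) (P : probability T R)
         (gam : forall n : nat, 'I_n -> 'I_n -> T -> R),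
    (forall n i j, measurable_fun setT (gam n i j)) ->
    (forall n i j (x : R), P [set t | gam n i j t <= x] = (pareto_cdf alpha x)%:E) ->
    (forall n, mutually_independent P (fun p : 'I_n * 'I_n => gam n p.1 p.2)) ->
    (fun n : nat => fine (P [set t | forall S : {set 'I_n},
        is_topk (fun i => gam n i i t) (k n) S ->
        c * (n%:R) `^ (1 / (1 + alpha)) <=
          (throughput N0 beta (fun i j => gam n i j t) S)%:R]))
      @ \oo --> (1 : R).
Proof.
move=> alpha2 beta0 N00.
(* Half the exponent of [r]: with [s = n^a] one has [r = s^2], and [ln n] grows no faster than
   [s]. *)
pose a := (2 * (1 + alpha))^-1.
pose r (n : nat) : R := n%:R `^ (1 / (1 + alpha)).
pose b := 1 + 16 * beta.
pose kap := b `^ (- alpha).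
have b1 : 1 <= b by rewrite /b; lra.
have b0 : 0 < b by lra.
have alpha1 : 0 < 1 + alpha by lra.
have a0 : 0 < a by rewrite invr_gt0; lra.
have kap0 : 0 < kap by exact: powR_gt0.
have kap1 : kap <= 1.
  by rewrite /kap -[leRHS](powRr0 b) ler_powR//; lra.
(* At least [k / 2] pairs succeed and [k >= lam / 4], where [lam = kap * r n]. *)
exists (kap / 8); split; first by rewrite divr_gt0.
exists (fun n => minn n (Num.trunc (kap * r n / 2))); split; first by move=> n; exact: geq_minl.
move=> d T P gam mgam cdf indep.
(* Since [s >= 1], [4 / lam + (1 + s / a) / lam <= (5 + 1 / a) s / (kap s^2) = C / s]. *)
pose C := (5 + a^-1) / kap.
apply: (@squeeze_cvgr _ _ _ _ (fun n : nat => 1 - (C * n%:R `^ (- a) + n%:R `^ (- (alpha - 2)))) (fun=> 1)).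
- near=> n.
  have n1 : (1 <= n)%N by near: n; exact: nbhs_infty_ge.
  have n1R : 1 <= n%:R :> R by rewrite ler1n.
  have n0R : 0 < n%:R :> R by rewrite ltr0n.
  (* The part [4 / kap] gives [lam >= 4], so truncating [lam / 2] loses at most [lam / 4]; the part
     [1 + beta * N0] pays for the noise and for the [- 1] in [x]. *)
  have rbig : 4 / kap + (1 + beta * N0) <= r n.
    near: n; apply/cvgryPge: (4 / kap + (1 + beta * N0)).
    by apply: natr_powR_cvgy; rewrite div1r invr_gt0.
  set lam := kap * r n.
  have bN0 : 0 <= beta * N0 by rewrite mulr_ge0// ltW.
  have kap4 : 0 < 4 / kap by rewrite divr_gt0.
  have r0 : 0 < r n by lra.
  have lam4 : 4 <= lam.
    have -> : 4 = kap * (4 / kap) by field; rewrite gt_eqF.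
    by rewrite /lam ler_pM2l//; lra.
  have lamr : lam <= r n by rewrite /lam ler_piMl// ltW.
  have rn : r n <= n%:R.
    by rewrite -[leRHS]powRr1// ler_powR// ler_pdivrMr//; lra.
  pose x := b * r n - 1.
  have x0 : 0 <= x by rewrite /x; nra.
  have lamE : lam = n%:R * (1 + x) `^ (- alpha).
    have -> : 1 + x = b * r n by rewrite /x; ring.
    rewrite powRM ?ltW// mulrCA -/kap /lam; congr (_ * _).
    have -> : n%:R = r n `^ (1 + alpha).
      by rewrite /r -powRrM divfK ?gt_eqF// powRr1.
    rewrite -powRD; last by rewrite (gt_eqF r0) implybT.
    by rewrite addrK powRr1 ?ltW.
  set k := minn _ _.
  have kE : k = minn n (Num.trunc (lam / 2)) by [].
  have k4 : lam / 4 <= k%:R.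
    rewrite kE /minn; case: ifP => _; first by lra.
    by have := truncnS_gt (lam / 2); rewrite -[X in _ < X -> _]natr1; lra.
  have k2 : k%:R <= lam / 2.
    apply: (@le_trans _ _ (Num.trunc (lam / 2))%:R); first by rewrite ler_nat kE geq_minr.
    by rewrite truncn_le; lra.
  have k0 : (0 < k)%N by rewrite -(ltr0n R); lra.
  set E := [set t | _].
  have mE : measurable E by exact: measurable_throughput_event.
  apply/andP; split; last first.
    by rewrite -lee_fin fineK ?fin_num_measure// probability_le1.
  apply: le_trans (@probability_throughput_ge R d T P n (gam n) alpha alpha2 (mgam n) (cdf n)
    (indep n) x x0 beta N0 _ k beta0 _ k0 _ _ _); rewrite -?lamE//.
  + rewrite lerD2l lerN2; apply: lerD.
      pose s := n%:R `^ a.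
      have s1 : 1 <= s by rewrite /s -[leLHS](powRr0 n%:R) ler_powR// ltW.
      have s0 : 0 < s by lra.
      have rs : r n = s ^+ 2.
        rewrite -powR_mulrn ?powR_ge0// -powRrM; congr (_ `^ _).
        by rewrite /a; field; rewrite gt_eqF.
      (* This is [ln s < s], as [ln s = a * ln n]. *)
      have lns : ln n%:R <= s / a.
        rewrite ler_pdivlMr// mulrC -ln_powR.
        by apply: ltW; apply: ln_sublinear.
      have H : \sum_(j < n) j.+1%:R^-1 <= 1 + s / a.
        by apply: (le_trans (sum_inv_le_ln R n n1)); rewrite lerD2l.
      have lam0 : 0 < lam by lra.
      have ai0 : 0 < a^-1 by rewrite invr_gt0.
      have Hk : (\sum_(j < n) j.+1%:R^-1) / (4 * k%:R) <= (1 + s / a) / lam.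
        have k40 : 0 < 4 * k%:R :> R by lra.
        apply: ler_pM; rewrite ?invr_ge0 ?lef_pV2 ?posrE//; try lra.
        by apply: sumr_ge0 => j _; rewrite invr_ge0 ler0n.
      apply: (le_trans (lerD (lexx _) Hk)); rewrite -mulrDl.
      rewrite powRN -/s /C ler_pdivrMr// /lam rs.
      have -> : (5 + a^-1) / kap / s * (kap * s ^+ 2) = (5 + a^-1) * s.
        by field; rewrite !gt_eqF.
      by nra.
    have -> : n%:R `^ (- (alpha - 2)) = n%:R ^+ 2 * n%:R `^ (- alpha) :> R.
      rewrite -powR_mulrn// -powRD; last by rewrite (gt_eqF n0R) implybT.
      by congr (_ `^ _); ring.
    rewrite ler_pM2l ?exprn_gt0// !powRN lef_pV2 ?posrE ?powR_gt0//.
    by rewrite ge0_ler_powR ?nnegrE ?ler0n ?ler_nat//; lra.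
  + lra.
  + by rewrite -mulrA [_^-1 * _]mulrC mulrA -/lam; lra.
  (* From [r n >= 1 + beta * N0] and [lam <= r n], [x = (r n - 1) + 16 * beta * r n] exceeds
     [beta * N0 + 8 * beta * lam]. *)
  + by rewrite /x /b; nra.
- rewrite -[X in _ --> X]subr0; apply: cvgB; first exact: cvg_cst.
  rewrite -[X in _ --> X](addr0 0); apply: cvgD; last by apply: natr_powRN_cvg0; lra.
  rewrite -(mulr0 C); apply: cvgMr; exact: natr_powRN_cvg0.
- exact: cvg_cst.
Unshelve. all: by end_near. Qed.
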